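(* Let $\omega,\omega'\in\{0,1\}^{\infty}$. The graphs $X_{\omega}$ and $X_{\omega'}$ are isomorphic if and only if the sequences $\omega$ and $\omega'$ are either cofinal or anticofinal.
   Context: $\{0,1\}^{\infty}$ is the set of infinite sequences $x_1x_2\ldots$ with $x_i\in\{0,1\}$; for $x\in\{0,1\}$ put $\overline{x}=1-x$. Definition of $X_\omega$. For $\omega=x_1x_2\ldots\in\{0,1\}^\infty$ and $n\ge 1$ put $a_n^{\omega}=\sum_{i=1}^n x_i2^{i-1}-2^{n-1}$. The graph $X_\omega$ is undirected with vertex set $V_\omega=\mathbb{Z}$. Its edges are those of the disjoint union $\coprod_{n\ge 0}E^n_\omega$, where $E^0_\omega=\{(z,z+1):z\in\mathbb{Z}\}$ and, for $n\ge1$, $E^n_\omega=\{(2^nz-a_n^\omega,\,2^n(z+1)-a_n^\omega):z\in\mathbb{Z}\}$; in addition, if there is a vertex not incident to any edge of $\coprod_{n\ge 1}E^n_\omega$ (there is at most one such vertex), a loop is added at that vertex. The graph $X_\omega$ is $4$-regular (a loop counts twice). Two sequences $\omega=x_1x_2\ldots$ and $\omega'=y_1y_2\ldots$ are cofinal (resp. anticofinal) if there exists $i_0$ such that $x_i=y_i$ (resp. $x_i=\overline{y}_i$) for every $i\ge i_0$. A graph isomorphism is a bijection between vertex sets preserving and reflecting adjacency (loops included). *)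

(* Defs.v *)
From mathcomp Require Import all_boot all_order all_algebra.

Set Implicit Arguments.
Unset Strict Implicit.
Unset Printing Implicit Defensive.

Import Order.TTheory GRing.Theory Num.Theory.
Local Open Scope ring_scope.

(* Undirected graphs without parallel edges, loops allowed. *)
Record graph := Graph {
  vertex : Type;
  adj : vertex -> vertex -> Prop;
  adj_sym : forall u v, adj u v -> adj v u
}.

Definition isomorphic (G H : graph) : Prop :=
  exists f : vertex G -> vertex H,
    bijective f /\ forall u v, adj u v <-> adj (f u) (f v).

(* Sequences are indexed from 0: the sequence x_1 x_2 ... is the function
   sending i to x_{i+1}, with true for 1 and false for 0. *)
Definition binseq := nat -> bool.

Definition cofinal (w w' : binseq) : Prop :=
  exists i0 : nat, forall i : nat, (i0 <= i)%N -> w i = w' i.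

Definition anticofinal (w w' : binseq) : Prop :=
  exists i0 : nat, forall i : nat, (i0 <= i)%N -> w i = ~~ w' i.

(* sum_{i=1}^n x_i 2^{i-1} - 2^{n-1}; only meaningful for n >= 1. *)
Definition offset (w : binseq) (n : nat) : int :=
  (\sum_(i < n) (w i)%:Z * 2 ^+ i) - 2 ^+ n.-1.

(* (u, v) belongs to E^n_w, before symmetrization. *)
Definition level_edge (w : binseq) (n : nat) (u v : int) : Prop :=
  if n == 0%N then v = u + 1
  else exists z : int,
    u = 2 ^+ n * z - offset w n /\ v = 2 ^+ n * (z + 1) - offset w n.

Definition incident_positive_level (w : binseq) (v : int) : Prop :=
  exists n u, (1 <= n)%N /\ (level_edge w n u v \/ level_edge w n v u).

(* An edge in E^n_w joins two integers at distance exactly 2^n, so the sets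
   E^n_w have no unordered pair in common, and their disjoint union is
   faithfully described by an adjacency relation. *)
Definition X_adj (w : binseq) (u v : int) : Prop :=
  (exists n, level_edge w n u v \/ level_edge w n v u)
  \/ (u = v /\ ~ incident_positive_level w u).

Lemma X_adj_sym (w : binseq) (u v : int) : X_adj w u v -> X_adj w v u.
Proof.
case=> [[n [uv|vu]]|[-> vP]]; first by left; exists n; right.
  by left; exists n; left.
by right.
Qed.

Definition X (w : binseq) : graph := Graph (@X_adj_sym w).

(* Main.v *)
(* Writing w as a 2-adic integer, a vertex u has edges of length 2 ^ n, n >= 1,
   exactly when u + w has 2-adic valuation n - 1. So each vertex lies in
   at most one positive level, and the triangles of X w are the sets
   {t, t + 1, t + 2} with t of level 1. The edges of length 1 are thus
   those lying in a triangle and having an endpoint all of whose triangles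
   contain the other endpoint; an isomorphism preserves them, hence has the form
   u |-> u + c or u |-> c - u. Since u |-> 1 - u maps X w onto the graph of the
   complementary sequence, only translations matter, and a translation by c is
   an isomorphism exactly when w = w' + c in the 2-adic integers. *)

Require Import Defs.
From mathcomp Require Import all_boot all_order all_algebra.
From mathcomp Require Import zify ring.
From Stdlib Require Import Classical.

Set Implicit Arguments.
Unset Strict Implicit.
Unset Printing Implicit Defensive.

Import Order.TTheory GRing.Theory Num.Theory.
Local Open Scope ring_scope.

(** * Powers of two in the integers *)

Lemma expr2z_gt0 n : 0 < 2 ^+ n :> int.
Proof. exact: exprn_gt0. Qed.

Lemma expr2z_neq0 n : 2 ^+ n != 0 :> int.
Proof. by rewrite gt_eqF ?expr2z_gt0. Qed.

Lemma expr2z_lt m n : 2 ^+ m < 2 ^+ n :> int -> 2 * 2 ^+ m <= 2 ^+ n :> int.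
Proof. by rewrite ltr_eXn2l // -exprS ler_eXn2l. Qed.

Lemma expr2z_inj m n : 2 ^+ m = 2 ^+ n :> int -> m = n.
Proof. exact: ieexprIn. Qed.

(** Each summand is a power of two strictly below [2 ^+ k], hence at most half of it, so both are
    exactly half. *)
Lemma expr2zD_eq m n k :
  2 ^+ m + 2 ^+ n = 2 ^+ k :> int -> m = n /\ k = n.+1.
Proof.
move=> e; have := expr2z_gt0 m; have := expr2z_gt0 n => n0 m0.
have a : 2 * 2 ^+ m <= 2 ^+ k :> int by apply: expr2z_lt; lia.
have b : 2 * 2 ^+ n <= 2 ^+ k :> int by apply: expr2z_lt; lia.
split; apply: expr2z_inj; rewrite ?exprS; lia.
Qed.

(** * Levels of vertices and their relation to adjacency *)

(** At [n = 0] the meaningless value of [offset] is harmless, since 1 divides everything. *)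
Definition level (w : binseq) (n : nat) (u : int) : bool :=
  (2 ^+ n %| u + offset w n)%Z.

Lemma level0 w u : level w 0 u.
Proof. by rewrite /level expr0 dvd1z. Qed.

Lemma level1 w u : level w 1 u = (2 %| u + (w 0%N)%:Z - 1)%Z.
Proof. by rewrite /level /offset big_ord1 !expr0 expr1 mulr1 addrA. Qed.

Lemma level_addX w n u : level w n (u + 2 ^+ n) = level w n u.
Proof. by rewrite /level addrAC rpredDr ?dvdzz. Qed.

Lemma level_edgeP w n u v :
  level_edge w n u v <-> v = u + 2 ^+ n /\ level w n u.
Proof.
rewrite /level_edge; case: n => [|n] /=.
  by rewrite level0 expr0; split=> [->|[]].
split=> [[z [-> ->]]|[-> /dvdzP[z e]]].
  by split; [ring | rewrite /level subrK dvdz_mulr].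
by exists z; split; lia.
Qed.

(** Level [n] is invariant under translation by [2 ^+ n], so testing one endpoint of an edge covers
    both orientations. *)
Lemma X_adjP w u v :
  X_adj w u v <-> (exists n, `|u - v| = 2 ^+ n /\ level w n u) \/
    (u = v /\ forall n, (1 <= n)%N -> ~~ level w n u).
Proof.
have edgeP n a b : (level_edge w n a b \/ level_edge w n b a) <->
    `|a - b| = 2 ^+ n /\ level w n a.
  rewrite !level_edgeP; have p := expr2z_gt0 n; split.
    case=> [[-> l]|[-> l]]; split=> //; rewrite ?level_addX //; lia.
  case=> d l; have [->|e] : b = a + 2 ^+ n \/ a = b + 2 ^+ n by lia.
    by left.
  by right; rewrite e level_addX in l *.
have incP a : ~ incident_positive_level w a <->
    forall n, (1 <= n)%N -> ~~ level w n a.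
  split=> [h n n1|h [n [b [n1 /or_comm/edgeP[_ l]]]]].
    apply/negP => l; apply: h; exists n, (a + 2 ^+ n); split=> //.
    by right; apply/level_edgeP.
  by case/negP: (h n n1).
rewrite /X_adj incP; split=> -[[n h]|h]; try by right.
  by left; exists n; apply/edgeP.
by left; exists n; apply/edgeP.
Qed.

Definition partial_sum (w : binseq) (n : nat) : int :=
  \sum_(i < n) (w i)%:Z * 2 ^+ i.

Lemma offsetE w n : offset w n = partial_sum w n - 2 ^+ n.-1.
Proof. by []. Qed.

Lemma partial_sumS w n :
  partial_sum w n.+1 = partial_sum w n + (w n)%:Z * 2 ^+ n.
Proof. exact: big_ord_recr. Qed.

Lemma partial_sum_bounds w n : 0 <= partial_sum w n < 2 ^+ n.
Proof.
elim: n => [|n IHn]; first by rewrite /partial_sum big_ord0.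
by rewrite partial_sumS exprS; case: (w n); lia.
Qed.

Lemma partial_sum_compl w n :
  partial_sum (fun i => ~~ w i) n = 2 ^+ n - 1 - partial_sum w n.
Proof.
elim: n => [|n IHn]; first by rewrite /partial_sum !big_ord0.
by rewrite !partial_sumS IHn exprS; case: (w n) => /=; ring.
Qed.

(** For positive [n], consecutive offsets differ by an odd multiple of [2 ^+ n.-1], so even [2 ^+ n]
    cannot divide both translates of [u]. *)
Lemma level_succ w n u : (1 <= n)%N -> level w n u -> ~~ level w n.+1 u.
Proof.
case: n => // n _ /dvdzP[y]; rewrite offsetE /= => ey.
apply/negP => /dvdzP[z].
rewrite offsetE /= partial_sumS.
rewrite !exprS in ey *; have := expr2z_gt0 n => p e.
have : 2 ^+ n * (2 * y + 1 + 2 * (w n.+1)%:Z - 2 - 4 * z) = 0 by lia.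
move/eqP; rewrite mulf_eq0 gt_eqF //= => /eqP; lia.
Qed.

Lemma X_isometry w w' (f : int -> int) :
  (forall u v, `|f u - f v| = `|u - v|) ->
  (forall n u, (1 <= n)%N -> level w n u = level w' n (f u)) ->
  forall u v, X_adj w u v <-> X_adj w' (f u) (f v).
Proof.
move=> fd fl u v; rewrite !X_adjP fd.
have fl' n : level w n u = level w' n (f u)
  by case: n => [|n]; rewrite ?level0 ?fl.
split=> -[[n [d l]]|[e h]].
- by left; exists n; rewrite -fl'.
- by right; rewrite e; split=> // n n1; rewrite -e -fl'; apply: h.
- by left; exists n; rewrite fl'.
- by right; split=> [|n n1]; [have := fd u v; lia | rewrite fl' h].
Qed.

(** For [n >= 1], complementing the digits turns the offset [a] into [- 1 - a], so the reflection
    only changes the sign of [u + a]. *)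
Lemma X_compl_adj w u v :
  X_adj w u v <-> X_adj (fun i => ~~ w i) (1 - u) (1 - v).
Proof.
apply: (X_isometry (f := fun x => 1 - x)) => [a b|[//|n] a _]; first lia.
rewrite /level !offsetE partial_sum_compl -[RHS]rpredN.
by congr (_ %| _)%Z; rewrite exprS; ring.
Qed.

(** * Triangles and short edges, invariant under isomorphism *)

Definition link (G : graph) (u v : vertex G) : Prop := u <> v /\ adj u v.

Lemma link_sym (G : graph) (u v : vertex G) : link u v -> link v u.
Proof. by case=> uv /adj_sym; split=> // /esym. Qed.

Definition triangle (G : graph) (u v x : vertex G) : Prop :=
  [/\ link u v, link v x & link u x].

Lemma triangle_rot (G : graph) (u v x : vertex G) :
  triangle u v x -> triangle v x u.
Proof. by case=> *; split=> //; apply: link_sym. Qed.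

Lemma triangle_swap (G : graph) (u v x : vertex G) :
  triangle u v x -> triangle v u x.
Proof. by case=> *; split=> //; apply: link_sym. Qed.

(** Not symmetric: the first argument is the endpoint all of whose triangles contain the other
    one. *)
Definition short_edge (G : graph) (u v : vertex G) : Prop :=
  (exists x, triangle u v x) /\ (forall x y, triangle u x y -> v = x \/ v = y).

Lemma triangle_iso (G H : graph) (f : vertex G -> vertex H) u v x :
  injective f -> (forall a b, adj a b <-> adj (f a) (f b)) ->
  triangle u v x <-> triangle (f u) (f v) (f x).
Proof.
move=> fI fA; have fL a b : link a b <-> link (f a) (f b).
  by rewrite /link -fA; split=> -[ab ?]; split=> // e; apply: ab;
    first [exact: fI | rewrite e].
by split=> -[/fL ? /fL ? /fL ?].
Qed.

Lemma short_edge_iso (G H : graph) (f : vertex G -> vertex H) u v :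
  bijective f -> (forall a b, adj a b <-> adj (f a) (f b)) ->
  short_edge u v -> short_edge (f u) (f v).
Proof.
move=> fB fA; have fI := bij_inj fB; case: fB => g fK gK [[x t] uvP].
split=> [|a b]; first by exists (f x); apply/(triangle_iso _ _ _ fI fA).
rewrite -(gK a) -(gK b) => /(triangle_iso _ _ _ fI fA)/uvP.
by case=> ->; [left | right].
Qed.

(** * Triangles and short edges of [X w] *)

Lemma X_adj_lt w u v : u < v -> X_adj w u v ->
  exists n, v = u + 2 ^+ n /\ level w n u.
Proof.
move=> uv /X_adjP[[n [d l]]|[e _]]; last by lia.
by exists n; split=> //; lia.
Qed.

Lemma X_adj_level w n u : level w n u -> X_adj w u (u + 2 ^+ n).
Proof.
move=> l; apply/X_adjP; left; exists n; split=> //.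
by have := expr2z_gt0 n; lia.
Qed.

Lemma X_adj_succ w u : X_adj w u (u + 1).
Proof. by rewrite -(expr0 2); apply/X_adj_level/level0. Qed.

(** The two shorter sides have equal length [2 ^+ n] and the longest has length [2 ^+ n.+1]; so [u]
    has levels [n] and [n.+1], which forces [n = 0]. *)
Lemma X_triangle_lt w u v x : u < v -> v < x ->
  X_adj w u v -> X_adj w v x -> X_adj w u x ->
  [/\ level w 1 u, v = u + 1 & x = u + 2].
Proof.
move=> uv vx /(X_adj_lt uv)[n [ev l]] /(X_adj_lt vx)[m [ex _]].
move=> /(X_adj_lt (lt_trans uv vx))[k [ex' l']].
have /expr2zD_eq[e ek] : 2 ^+ n + 2 ^+ m = 2 ^+ k :> int by lia.
subst m k; case: n => [|n] in l l' ev ex ex' *.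
  by rewrite expr0 in ev ex; split=> //; lia.
by case/negP: (level_succ (n := n.+1) isT l).
Qed.

(* The conclusion is stated as membership in an interval to make it symmetric
   in the three vertices. *)
Lemma X_triangle w (u v x : vertex (X w)) : triangle u v x ->
  exists t : int, level w 1 t /\
    [/\ t <= u <= t + 2, t <= v <= t + 2 & t <= x <= t + 2].
Proof.
rewrite /= in u v x *; case=> /= -[/= uv auv] [vx avx] [ux aux].
have [avu axv axu] :
    [/\ X_adj w v u, X_adj w x v & X_adj w x u] by split; apply: X_adj_sym.
(* One case per ordering of the vertices; the witness is the smallest. *)
case: (ltgtP u v) => // luv; case: (ltgtP v x) => // lvx;
  case: (ltgtP u x) => // lux; try lia;
  [ have [l e1 e2] := X_triangle_lt luv lvx auv avx aux; exists u
  | have [l e1 e2] := X_triangle_lt lux lvx aux axv auv; exists u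
  | have [l e1 e2] := X_triangle_lt lux luv axu auv axv; exists x
  | have [l e1 e2] := X_triangle_lt luv lux avu aux avx; exists v
  | have [l e1 e2] := X_triangle_lt lvx lux avx axu avu; exists v
  | have [l e1 e2] := X_triangle_lt lvx luv axv avu axu; exists x ];
  by split=> //; split; lia.
Qed.

Lemma X_level1_triangle w (t : int) : level w 1 t ->
  triangle (t : vertex (X w)) (t + 1) (t + 2).
Proof.
move=> l; have e : t + 2 = t + 1 + 1 by lia.
split; split=> /=; try lia; [exact: X_adj_succ | rewrite e; exact: X_adj_succ |
  exact: (X_adj_level l)].
Qed.

(** An extreme vertex of one triangle is also extreme in the next one, which shares no other vertex
    with it; hence [u] is the middle of its triangle. *)
Lemma X_short_edge_dist w (u v : vertex (X w)) :
  short_edge u v -> `|u - v : int| = 1 :> int.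
Proof.
rewrite /= in u v *.
case=> -[x t] uvP; have [s [l [/= us vs _]]] := X_triangle t.
have uv : u <> v by case: t => -[].
have [e|[e|e]] : u = s \/ u = s + 1 \/ u = s + 2 by lia.
- have l' : level w 1 (u - 2) by rewrite -(level_addX w 1) subrK e.
  have := triangle_rot (triangle_rot (X_level1_triangle l')).
  by rewrite subrK => /uvP /=; lia.
- lia.
- have l' : level w 1 u by rewrite e level_addX.
  by have /= := uvP _ _ (X_level1_triangle l'); lia.
Qed.

Lemma X_short_edge_even w (t : int) : level w 1 t ->
  short_edge (t + 1 : vertex (X w)) t /\
  short_edge (t + 1 : vertex (X w)) (t + 2).
Proof.
move=> l; have T := X_level1_triangle l.
have only x y : triangle (t + 1 : vertex (X w)) x y ->
    (x = t \/ x = t + 2) /\ (y = t \/ y = t + 2) /\ x <> y.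
  move=> T'; have [s [ls [/= h1 h2 h3]]] := X_triangle T'.
  rewrite /= in x y T' h2 h3 *.
  case: T' => -[/= d1 _] [d2 _] [d3 _]; rewrite !level1 in l ls.
  lia.
split; split; try by move=> x y /only /=; lia.
  by exists (t + 2); apply: triangle_swap.
by exists t; apply: triangle_rot.
Qed.

Lemma X_dist_short_edge w (u : int) :
  short_edge (u : vertex (X w)) (u + 1) \/ short_edge (u + 1 : vertex (X w)) u.
Proof.
have [l|l] : level w 1 u \/ level w 1 (u - 1) by rewrite !level1; lia.
  by right; case: (X_short_edge_even l).
left; case: (X_short_edge_even l) => _; rewrite /= subrK.
by have -> : u - 1 + 2 = u + 1 by lia.
Qed.

(** * Isomorphisms are translations or reflections *)

Lemma X_iso_dist w w' (f : int -> int) : bijective f ->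
  (forall u v, X_adj w u v <-> X_adj w' (f u) (f v)) ->
  forall u, `|f u - f (u + 1)| = 1 :> int.
Proof.
move=> fB fA u.
have step a b : short_edge (a : vertex (X w)) b -> `|f a - f b| = 1 :> int.
  by move/(@short_edge_iso (X w) (X w') f a b fB fA)/X_short_edge_dist.
by case: (X_dist_short_edge w u) => /step; rewrite // distrC.
Qed.

Lemma int_constant T (g : int -> T) :
  (forall u, g (u + 1) = g u) -> forall u, g u = g 0.
Proof.
move=> gS; elim=> [//|n <-|n <-]; last by rewrite -gS; congr (g _); lia.
by rewrite -[RHS]gS; congr (g _); lia.
Qed.

Lemma int_unit_steps (f : int -> int) : injective f ->
  (forall u, `|f u - f (u + 1)| = 1 :> int) ->
  (exists c, forall u, f u = u + c) \/ (exists c, forall u, f u = c - u).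
Proof.
move=> fI fd; pose d u := f (u + 1) - f u.
(* Opposite consecutive steps would give [f u = f (u + 1 + 1)], against injectivity. *)
have dS u : d (u + 1) = d u.
  have h : f u <> f (u + 1 + 1) by move/fI; lia.
  rewrite /d; move: (fd u) (fd (u + 1)) h.
  by move: (f u) (f (u + 1)) (f (u + 1 + 1)); lia.
have lin u : f u = f 0 + u * d 0.
  have := @int_constant _ (fun v => f v - v * d 0) _ u; rewrite mul0r subr0.
  move=> <- => [|v]; first by rewrite subrK.
  by rewrite -(int_constant dS v) /d; ring.
have [e|e] : d 0 = 1 \/ d 0 = -1.
  by rewrite /d; move: (fd 0); move: (f 0) (f (0 + 1)); lia.
- by left; exists (f 0) => u; rewrite lin e mulr1 addrC.
- by right; exists (f 0) => u; rewrite lin e mulrN1.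
Qed.

(** * Translations and 2-adic congruences *)

Lemma X_shift_congr w w' c :
  (forall u v, X_adj w u v -> X_adj w' (u + c) (v + c)) ->
  forall n, (2 ^+ n %| partial_sum w' n - partial_sum w n + c)%Z.
Proof.
(* This [u] has level [n] for [w]; its edge of length [2 ^+ n] is translated to one of the same
   length, so [u + c] has level [n] for [w']. *)
move=> fA n; set u := - offset w n; have p := expr2z_gt0 n.
have /fA/X_adj_lt[|m [e]] : X_adj w u (u + 2 ^+ n); last 1 first.
- have /expr2z_inj <- : 2 ^+ n = 2 ^+ m :> int by lia.
  rewrite /level /u !offsetE.
  by congr (_ %| _)%Z; ring.
- by apply: X_adj_level; rewrite /level addNr dvdz0.
- by rewrite ltrD2r ltrDl.
Qed.

(* The quotient d of partial_sum w' n - partial_sum w n + c by 2 ^ n is a carry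
   with values in {-1, 0, 1} for large n: once it is 0 the sequences agree, and
   as long as it is nonzero they differ. *)
Lemma congr_cofinal w w' c :
  (forall n, (2 ^+ n %| partial_sum w' n - partial_sum w n + c)%Z) ->
  cofinal w w' \/ anticofinal w w'.
Proof.
move=> h; pose r n := partial_sum w' n - partial_sum w n + c.
have rS n : r n.+1 = r n + ((w' n)%:Z - (w n)%:Z) * 2 ^+ n.
  by rewrite /r !partial_sumS; ring.
(* Here [c] is below [2 ^+ n] in absolute value, so [r n] is below [2 ^+ n.+1]. The witness [d'] is
   the next carry. *)
have carry n : (`|c| <= n)%N -> exists d : int, [/\ r n = d * 2 ^+ n,
    -1 <= d <= 1 & exists d', d + ((w' n)%:Z - (w n)%:Z) = 2 * d'].
  move=> cn; have /dvdzP[d e] := h n; exists d; split=> //.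
    have c2 : `|c| < 2 ^+ n.
      have := ltn_expl n (isT : (1 < 2)%N); rewrite -ltz_nat -natrX natz; lia.
    have := partial_sum_bounds w n; have := partial_sum_bounds w' n.
    by have := expr2z_gt0 n; nia.
  have /dvdzP[d' e'] := h n.+1; exists d'.
  apply: (mulIf (expr2z_neq0 n)).
  by move: e'; rewrite -/(r _) rS /r e exprS; lia.
case: (classic (exists2 n, (`|c| <= n)%N & r n = 0)) => [[n cn r0]|nz].
  left; exists n.
  have step i : (n <= i)%N -> r i = 0 -> w i = w' i.
    move=> ni ri; have [|d [e _ [d' e']]] := carry i; first lia.
    have d0 : d = 0.
      by apply: (mulIf (expr2z_neq0 i)); rewrite -e ri mul0r.
    by move: e'; rewrite d0; case: (w i); case: (w' i) => /=; lia.
  have all0 k : r (n + k)%N = 0.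
    elim: k => [|k IHk]; first by rewrite addn0.
    by rewrite addnS rS IHk (step _ _ IHk) ?leq_addr // subrr mul0r.
  by move=> i ni; apply: step => //; rewrite -(subnKC ni).
right; exists `|c|%N => i ci; have [d [e db [d' e']]] := carry i ci.
have d0 : d <> 0 by move=> d0; apply: nz; exists i => //; rewrite e d0 mul0r.
by case: (w i) e'; case: (w' i) => /=; lia.
Qed.

Lemma partial_sum_dvd w m n :
  (m <= n)%N -> (2 ^+ m %| partial_sum w n - partial_sum w m)%Z.
Proof.
elim: n => [|n IHn]; first by rewrite leqn0 => /eqP->; rewrite subrr dvdz0.
rewrite leq_eqVlt => /predU1P[->|]; first by rewrite subrr dvdz0.
move=> mn; rewrite partial_sumS addrAC rpredD ?IHn // dvdz_mull //.
by rewrite dvdz_exp2l.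
Qed.

(** * Isomorphisms built from (anti)cofinality *)

Lemma isomorphic_trans G H K :
  isomorphic G H -> isomorphic H K -> isomorphic G K.
Proof.
move=> [f [fB fA]] [g [gB gA]]; exists (g \o f); split; first exact: bij_comp.
by move=> u v; rewrite fA gA.
Qed.

Lemma cofinal_X_isomorphic w w' : cofinal w w' -> isomorphic (X w) (X w').
Proof.
move=> [m ww']; set c := partial_sum w m - partial_sum w' m.
exists (fun u : int => u + c); split.
  by exists (fun u : int => u - c) => u; rewrite ?addrK ?subrK.
have large k : partial_sum w' (m + k) + c = partial_sum w (m + k).
  elim: k => [|k IHk]; first by rewrite addn0 /c; ring.
  by rewrite addnS !partial_sumS -IHk ww' ?leq_addr //; ring.
(* Equality holds at index [m + n] by [large]; reducing it modulo [2 ^+ n] also covers [n < m]. *)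
have congr n : (2 ^+ n %| partial_sum w' n + c - partial_sum w n)%Z.
  have -> : partial_sum w' n + c - partial_sum w n =
    (partial_sum w (m + n) - partial_sum w n)
      - (partial_sum w' (m + n) - partial_sum w' n) by rewrite -large; ring.
  by rewrite rpredB ?partial_sum_dvd ?leq_addl.
apply: X_isometry => [u v|n u _]; first lia.
rewrite /level !offsetE -[RHS](rpredBr _ (congr n)).
by congr (_ %| _)%Z; ring.
Qed.

Lemma X_compl_isomorphic w : isomorphic (X w) (X (fun i => ~~ w i)).
Proof.
exists (fun u : int => 1 - u); split; last exact: X_compl_adj.
by exists (fun u : int => 1 - u) => u; rewrite subKr.
Qed.

Theorem theorem1 (w w' : binseq) :
  isomorphic (X w) (X w') <-> (cofinal w w' \/ anticofinal w w').
Proof.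
split=> [[f [fB fA]]|[|[m ww']]]; last 2 first.
- exact: cofinal_X_isomorphic.
- apply: isomorphic_trans (X_compl_isomorphic w) _; apply: cofinal_X_isomorphic.
  by exists m => i /ww'->; rewrite negbK.
have [[c fE]|[c fE]] := int_unit_steps (bij_inj fB) (X_iso_dist fB fA).
  apply: (@congr_cofinal _ _ c); apply: X_shift_congr => u v.
  by rewrite -!fE; case: (fA u v).
(* Composing [u |-> c - u] with the reflection [u |-> 1 - u] gives a translation by [1 - c] into the
   complementary graph. *)
have h u v : X_adj w u v ->
    X_adj (fun i => ~~ w' i) (u + (1 - c)) (v + (1 - c)).
  have E a : a + (1 - c) = 1 - f a by rewrite fE; lia.
  by rewrite !E -X_compl_adj; case: (fA u v).
case: (congr_cofinal (X_shift_congr h)) => -[m ww'].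
  by right; exists m.
by left; exists m => i /ww'; rewrite negbK.
Qed.
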